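(* Let $\Gamma$ be a Coxeter graph. Let $A[\hat\Gamma]$ have standard generators $\{\hat\delta_\beta\mid\beta\in\Phi[\Gamma]\}$. Then the map $\hat\delta_\beta\mapsto\delta_\beta$ ($\beta\in\Phi[\Gamma]$) induces an isomorphism $A[\hat\Gamma]\to KVA[\Gamma]$. In particular $KVA[\Gamma]$ is an Artin group, generated by $\{\delta_\beta\mid\beta\in\Phi[\Gamma]\}$.
   Context: A Coxeter matrix on a countable set $S$ is a symmetric matrix $M=(m_{s,t})_{s,t\in S}$ with entries in $\mathbb{N}\cup\{\infty\}$ such that $m_{s,s}=1$ for all $s$ and $m_{s,t}=m_{t,s}\ge 2$ for $s\neq t$; it is encoded by a Coxeter graph $\Gamma$ with vertex set $S$ ($\Gamma$ is called finite if $S$ is finite). For letters $a,b$ and an integer $m\ge 2$, $\Pi_L(a,b,m)$ denotes the alternating word $aba\cdots$ of length $m$ beginning with $a$, and $\Pi_R(b,a,m)$ denotes the alternating word $\cdots aba$ of length $m$ ending with $a$; the same notation denotes the elements these words represent in a group. The Artin group $A[\Gamma]$ is given by the presentation $\langle S\mid \Pi_R(t,s,m_{s,t})=\Pi_R(s,t,m_{s,t})\text{ for } s\neq t,\ m_{s,t}\neq\infty\rangle$, and the Coxeter group $W[\Gamma]$ is the quotient of $A[\Gamma]$ by the relations $s^2=1$, $s\in S$. The virtual Artin group $VA[\Gamma]$ is the group generated by two sets $\{\sigma_s\mid s\in S\}$ and $\{\tau_s\mid s\in S\}$ in bijection with $S$, subject to the following relations, for all $s,t\in S$ with $s\neq t$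 and $m_{s,t}\neq\infty$: (v1) $\Pi_R(\sigma_t,\sigma_s,m_{s,t})=\Pi_R(\sigma_s,\sigma_t,m_{s,t})$; (v2) $\Pi_R(\tau_t,\tau_s,m_{s,t})=\Pi_R(\tau_s,\tau_t,m_{s,t})$, together with $\tau_s^2=1$ for all $s\in S$; (v3) $\Pi_R(\tau_s,\tau_t,m_{s,t}-1)\,\sigma_s=\sigma_r\,\Pi_R(\tau_s,\tau_t,m_{s,t}-1)$, where $r=s$ if $m_{s,t}$ is even and $r=t$ if $m_{s,t}$ is odd. We have homomorphisms $\iota_A:A[\Gamma]\to VA[\Gamma]$, $s\mapsto\sigma_s$; $\iota_W:W[\Gamma]\to VA[\Gamma]$, $s\mapsto\tau_s$; $\pi_K:VA[\Gamma]\to W[\Gamma]$, $\sigma_s\mapsto 1$, $\tau_s\mapsto s$; and $\pi_P:VA[\Gamma]\to W[\Gamma]$, $\sigma_s\mapsto s$, $\tau_s\mapsto s$. Set $KVA[\Gamma]=\ker\pi_K$ and $PVA[\Gamma]=\ker\pi_P$. Let $V$ be the real vector space with basis $\{\alpha_s\mid s\in S\}$ (simple roots), with the canonical symmetric bilinear form $\langle\alpha_s,\alpha_t\rangle=-2\cos(\pi/m_{s,t})$ if $m_{s,t}\neq\infty$ and $=-2$ if $m_{s,t}=\infty$. $W[\Gamma]$ acts faithfully on $V$ by $s(v)=v-\langle v,\alpha_s\rangle\alpha_s$. The root system is $\Phi[\Gamma]=\{w(\alpha_s)\mid w\in W[\Gamma],s\in S\}$. For $\beta\in\Phi[\Gamma]$,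 $r_\beta\in W[\Gamma]$ is the reflection $v\mapsto v-\langle v,\beta\rangle\beta$. For $w\in W[\Gamma]$ and $g\in KVA[\Gamma]$ or $PVA[\Gamma]$ write $w\cdot g=\iota_W(w)g\iota_W(w)^{-1}$. For $\beta\in\Phi[\Gamma]$ choose $w\in W[\Gamma]$, $s\in S$ with $w(\alpha_s)=\beta$ and set $\delta_\beta=w\cdot\sigma_s\in KVA[\Gamma]$ and $\zeta_\beta=w\cdot(\tau_s\sigma_s)\in PVA[\Gamma]$ (these do not depend on the choice of $w,s$). Define the Coxeter matrix $\hat M=(\hat m_{\beta,\gamma})_{\beta,\gamma\in\Phi[\Gamma]}$ by $\hat m_{\beta,\beta}=1$, and for $\beta\neq\gamma$: $\hat m_{\beta,\gamma}=m_{s,t}$ if there exist $w\in W[\Gamma]$, $s,t\in S$ with $\beta=w(\alpha_s)$, $\gamma=w(\alpha_t)$, $m_{s,t}\neq\infty$ (this value is independent of choices), and $\hat m_{\beta,\gamma}=\infty$ otherwise. $\hat\Gamma$ is the Coxeter graph of $\hat M$ (vertex set $\Phi[\Gamma]$). *)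

(* Defs.v *)
From Stdlib Require Import Reals.
From mathcomp Require Import all_boot.

Set Implicit Arguments.
Unset Strict Implicit.
Unset Printing Implicit Defensive.

(* A word in the free group on X: letters (x, b), b = true meaning x^{-1}. *)
Definition word (X : Type) := seq (X * bool).

Definition pos_word (X : Type) (s : seq X) : word X := map (fun x => (x, false)) s.

Definition inv_word (X : Type) (w : word X) : word X :=
  rev (map (fun p => (p.1, ~~ p.2)) w).

Inductive pres_eq (X : Type) (Rel : word X -> word X -> Prop) : word X -> word X -> Prop :=
| pe_rel l r u v : Rel l r -> pres_eq Rel (u ++ l ++ v) (u ++ r ++ v)
| pe_free x b u v : pres_eq Rel (u ++ [:: (x, b); (x, ~~ b)] ++ v) (u ++ v)
| pe_refl w : pres_eq Rel w w
| pe_sym w1 w2 : pres_eq Rel w1 w2 -> pres_eq Rel w2 w1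
| pe_trans w1 w2 w3 : pres_eq Rel w1 w2 -> pres_eq Rel w2 w3 -> pres_eq Rel w1 w3.

Fixpoint PiL (X : Type) (a b : X) (k : nat) : seq X :=
  match k with 0 => [::] | k'.+1 => a :: PiL b a k' end.
Definition PiR (X : Type) (b a : X) (k : nat) : seq X := rev (PiL a b k).

(* m s t = Some k encodes m_{s,t} = k, None encodes infinity. *)
Definition coxeter_matrix (S : eqType) (m : S -> S -> option nat) : Prop :=
  (forall s, m s s = Some 1%N) /\
  (forall s t, m s t = m t s) /\
  (forall s t k, s <> t -> m s t = Some k -> (2 <= k)%N).

Definition artin_rel (S : Type) (m : S -> S -> option nat) (l r : word S) : Prop :=
  exists s t k, s <> t /\ m s t = Some k /\
    l = pos_word (PiR t s k) /\ r = pos_word (PiR s t k).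

Definition coxeter_rel (S : Type) (m : S -> S -> option nat) (l r : word S) : Prop :=
  artin_rel m l r \/ (exists s, l = pos_word [:: s; s] /\ r = [::]).

(* Virtual Artin group VA[Gamma]: generators inl s = sigma_s, inr s = tau_s. *)
Definition va_rel (S : Type) (m : S -> S -> option nat) (l r : word (S + S)) : Prop :=
  (exists s t k, s <> t /\ m s t = Some k /\
     (
       (l = pos_word (PiR (inl t) (inl s) k) /\ r = pos_word (PiR (inl s) (inl t) k))
     \/
       (l = pos_word (PiR (inr t) (inr s) k) /\ r = pos_word (PiR (inr s) (inr t) k))
     \/
       (l = pos_word (PiR (inr s) (inr t) k.-1 ++ [:: inl s]) /\
        r = pos_word (inl (if odd k then t else s) :: PiR (inr s) (inr t) k.-1))))
  \/
  (exists s, l = pos_word [:: inr s; inr s] /\ r = [::]).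

Definition piK_word (S : Type) (w : word (S + S)) : word S :=
  flatten (map (fun p : (S + S) * bool =>
                  match p.1 with inl _ => [::] | inr s => [:: (s, p.2)] end) w).

Local Open Scope R_scope.

Definition cox_form (S : Type) (m : S -> S -> option nat) (s t : S) : R :=
  match m s t with
  | Some k => Ropp (Rmult 2 (cos (Rdiv PI (INR k))))
  | None => Ropp 2
  end.

(* A vector of V is represented by a finite formal combination
   [(s1, c1); ...] meaning sum c_i alpha_{s_i}; its coefficient function: *)
Definition lincomb (S : Type) := seq (S * R).

Definition coef (S : eqType) (v : lincomb S) (t : S) : R :=
  foldr (fun p acc => Rplus (if p.1 == t then p.2 else 0) acc) 0 v.

Definition form_simple (S : Type) (m : S -> S -> option nat) (v : lincomb S) (s : S) : R :=
  foldr (fun p acc => Rplus (Rmult p.2 (cox_form m p.1 s)) acc) 0 v.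

Definition refl_simple (S : Type) (m : S -> S -> option nat) (s : S) (v : lincomb S) : lincomb S :=
  v ++ [:: (s, Ropp (form_simple m v s))].

Definition act_word (S : Type) (m : S -> S -> option nat) (w : seq S) (v : lincomb S) : lincomb S :=
  foldr (refl_simple m) v w.

Definition rootvec (S : eqType) (m : S -> S -> option nat) (w : seq S) (s : S) : S -> R :=
  coef (act_word m w [:: (s, 1)]).

Definition is_root (S : eqType) (m : S -> S -> option nat) (v : S -> R) : Prop :=
  exists w s, v = rootvec m w s.

Definition roots_of (S : eqType) (m : S -> S -> option nat) := {v : S -> R | is_root m v}.

Local Close Scope R_scope.

(* Relations of A[hat Gamma]: for beta <> gamma with hat m_{beta,gamma} = k
   finite, i.e. beta = w(alpha_s), gamma = w(alpha_t), m_{s,t} = k. *)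
Definition hat_artin_rel (S : eqType) (m : S -> S -> option nat)
    (l r : word (roots_of m)) : Prop :=
  exists (beta gamma : roots_of m) (w : seq S) (s t : S) (k : nat),
    beta <> gamma /\ sval beta = rootvec m w s /\ sval gamma = rootvec m w t /\
    m s t = Some k /\
    l = pos_word (PiR gamma beta k) /\ r = pos_word (PiR beta gamma k).

Definition tau_word (S : Type) (w : seq S) : word (S + S) := pos_word (map inr w).

Definition is_delta (S : eqType) (m : S -> S -> option nat) (beta : roots_of m)
    (d : word (S + S)) : Prop :=
  exists (w : seq S) (s : S), sval beta = rootvec m w s /\
    d = tau_word w ++ [:: (inl s, false)] ++ inv_word (tau_word w).

Definition extend_word (X Y : Type) (f : X -> word Y) (u : word X) : word Y :=
  flatten (map (fun p : X * bool => if p.2 then inv_word (f p.1) else f p.1) u).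

(* Main.v *)
(* VA is the semidirect product of A[hat Gamma] by W. In one direction, F sends
   A[hat Gamma] to VA as soon as delta_beta does not depend on the chosen w and
   s with beta = w(alpha_s), that is, as soon as w(alpha_s) = alpha_t implies
   w sigma_s = sigma_t w in VA. This is proved by induction on the length of w:
   peel off a dihedral coset, w = v u with u in W_(s,r) and v(alpha_s),
   v(alpha_r) nonnegative. Then v(u(alpha_s)) is simple only if u(alpha_s) is
   alpha_s or alpha_r, which for reduced u <> 1 means that u is the word of
   relation (v3). In the other direction, reading a word of VA from left to
   right while keeping track of the product p of the tau letters, and writing
   the root p(alpha_s) for each letter sigma_s, respects the relations of VA
   and is a left inverse of F. Group elements of W are never needed: only words
   and their action on V. *)
Require Import Defs.
From Stdlib Require Import Reals Lra Setoid Morphisms.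
From Stdlib Require Import FunctionalExtensionality ProofIrrelevance.
From mathcomp Require Import all_boot.

Set Implicit Arguments.
Unset Strict Implicit.
Unset Printing Implicit Defensive.

(** * Linear functionals and the action on V *)

Section Linear.
Local Open Scope R_scope.
Variables (S : eqType) (m : S -> S -> option nat).

(** A vector is a list in which an index may occur several times, so vectors are compared only
    through linear functionals; [f x] is the value at alpha_x. *)
Definition lin (f : S -> R) (v : lincomb S) : R :=
  foldr (fun p acc => p.2 * f p.1 + acc) 0 v.

Lemma lin_cat f u v : lin f (u ++ v) = lin f u + lin f v.
Proof. elim: u => [|p u IH] /=; [lra | rewrite IH; lra]. Qed.

Lemma lin_sub_scale f g c v :
  lin (fun x => f x - g x * c) v = lin f v - lin g v * c.
Proof. elim: v => [|p u IH] /=; [lra | rewrite IH; lra]. Qed.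

Lemma eq_lin f g v : f =1 g -> lin f v = lin g v.
Proof. by move=> fg; elim: v => //= p u ->; rewrite fg. Qed.

Lemma coefE (v : lincomb S) t : coef v t = lin (fun x => if x == t then 1 else 0) v.
Proof. by elim: v => //= p u ->; case: eqP => _; lra. Qed.

Lemma coef_cat (u v : lincomb S) t : coef (u ++ v) t = coef u t + coef v t.
Proof. by rewrite !coefE lin_cat. Qed.

Lemma lin_split f (v : lincomb S) x :
  lin f v = coef v x * f x + lin f [seq p <- v | p.1 != x].
Proof.
elim: v => [|p v IH] /=; first lra.
by rewrite IH; case: eqP => [->|_] /=; lra.
Qed.

Lemma lin_eq0 f (v : lincomb S) : (forall t, coef v t = 0) -> lin f v = 0.
Proof.
have [n] := ubnP (size v); elim: n v => // n IH [|p v] //= ltvn v0.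
have v0' t : lin (fun x => if x == t then 1 else 0) (p :: v) = 0.
  by rewrite -coefE; apply: v0.
have := lin_split f (p :: v) p.1; rewrite coefE v0' /= eqxx /= => ->.
set v1 := filter _ _; suff -> : lin f v1 = 0 by lra.
apply: IH; first by apply: leq_ltn_trans (ltvn : (size v < n)%N); rewrite size_filter count_size.
move=> t; have := lin_split (fun x => if x == t then 1 else 0) (p :: v) p.1.
by rewrite coefE !v0' /= eqxx /= -coefE -/v1; lra.
Qed.

Lemma lin_ext f (u v : lincomb S) : coef u =1 coef v -> lin f u = lin f v.
Proof.
move=> uv; pose nv := [seq (p.1, - p.2) | p <- v].
have linN g : lin g nv = - lin g v.
  by rewrite /nv; elim: v {uv nv} => [|p v IH] /=; [lra | rewrite IH; lra].
suff: lin f (u ++ nv) = 0 by rewrite lin_cat linN; lra.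
apply: lin_eq0 => t; rewrite coef_cat uv (coefE nv) linN -coefE; lra.
Qed.

Lemma form_simpleE v s : form_simple m v s = lin (fun x => cox_form m x s) v.
Proof. by []. Qed.

Lemma lin_refl f s v :
  lin f (refl_simple m s v) = lin f v - form_simple m v s * f s.
Proof. rewrite /refl_simple lin_cat /=; lra. Qed.

Lemma act_cat u w v : act_word m (u ++ w) v = act_word m u (act_word m w v).
Proof. by rewrite /act_word foldr_cat. Qed.

Lemma lin_act f w v :
  lin f (act_word m w v) = lin (fun s => lin f (act_word m w [:: (s, 1)])) v.
Proof.
elim: w f => [|a w IH] f /=.
  by apply: eq_lin => x /=; lra.
rewrite lin_refl form_simpleE !(IH _) -lin_sub_scale.
by apply: eq_lin => x; rewrite lin_refl.
Qed.

Lemma coef_act w (v : lincomb S) t :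
  coef (act_word m w v) t = lin (fun s => rootvec m w s t) v.
Proof. by rewrite coefE lin_act; apply: eq_lin => x; rewrite -coefE. Qed.

Lemma act_ext w (u v : lincomb S) : coef u =1 coef v ->
  coef (act_word m w u) =1 coef (act_word m w v).
Proof. by move=> uv t; rewrite !coef_act; apply: lin_ext. Qed.

Lemma coef_refl s (v : lincomb S) t : coef (refl_simple m s v) t =
  coef v t - (if s == t then form_simple m v s else 0).
Proof. by rewrite !coefE lin_refl; case: eqP => _; lra. Qed.

Lemma rootvec_nil (s t : S) : rootvec m [::] s t = if s == t then 1 else 0.
Proof. by rewrite /rootvec /=; lra. Qed.

Lemma rootvec_cat u w (s t : S) :
  rootvec m (u ++ w) s t = lin (fun x => rootvec m u x t) (act_word m w [:: (s, 1)]).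
Proof. by rewrite /rootvec act_cat coef_act. Qed.

End Linear.

(** * Chebyshev numbers and their signs at 2 cos (PI / n) *)

Section Chebyshev.
Local Open Scope R_scope.

(* The Chebyshev numbers U_(k-1)(x / 2), that is sin (k a) / sin a for x = 2 cos a. *)
Fixpoint cheb (x : R) (k : nat) : R :=
  match k with
  | 0 => 0
  | k1.+1 => if k1 is k2.+1 then x * cheb x k1 - cheb x k2 else 1
  end.

Lemma chebSS x k : cheb x k.+2 = x * cheb x k.+1 - cheb x k.
Proof. by []. Qed.

Lemma cheb_sin a k : sin a * cheb (2 * cos a) k = sin (INR k * a).
Proof.
suff: sin a * cheb (2 * cos a) k = sin (INR k * a) /\
      sin a * cheb (2 * cos a) k.+1 = sin (INR k.+1 * a) by case.
elim: k => [|k [IH0 IH1]].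
  by split; rewrite /= ?Rmult_0_l ?sin_0 ?Rmult_1_l ?Rmult_0_r ?Rmult_1_r.
split=> //; rewrite chebSS.
have -> : sin a * (2 * cos a * cheb (2 * cos a) k.+1 - cheb (2 * cos a) k) =
  2 * cos a * (sin a * cheb (2 * cos a) k.+1) - sin a * cheb (2 * cos a) k by ring.
rewrite IH0 IH1.
have -> : INR k * a = INR k.+1 * a - a by rewrite S_INR; ring.
have -> : INR k.+2 * a = INR k.+1 * a + a by rewrite (S_INR k.+1); ring.
by rewrite sin_minus sin_plus; ring.
Qed.

(** The case of infinite m_(s,t): the angle is zero and the quotient of sines degenerates. *)
Lemma cheb2 k : cheb 2 k = INR k.
Proof.
suff: cheb 2 k = INR k /\ cheb 2 k.+1 = INR k.+1 by case.
elim: k => [|k [IH0 IH1]]; first by [].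
by split=> //; rewrite chebSS IH0 IH1 !S_INR; ring.
Qed.

Section Angle.
Variable n : nat.
Hypothesis n_gt1 : (1 < n)%N.

Let n_ge2 : 2 <= INR n.
Proof. by have := le_INR 2 n (leP n_gt1). Qed.

Lemma sin_PI_div_gt0 : 0 < sin (PI / INR n).
Proof.
have PI0 := PI_RGT_0.
apply: sin_gt_0; first by apply: Rdiv_lt_0_compat; lra.
apply: (Rmult_lt_reg_r (INR n)); first lra.
rewrite /Rdiv Rmult_assoc Rinv_l; nra.
Qed.

Lemma cheb_gt0 k : (0 < k)%N -> (k < n)%N -> 0 < cheb (2 * cos (PI / INR n)) k.
Proof.
move=> k0 kn; have s0 := sin_PI_div_gt0; have PI0 := PI_RGT_0.
have k0' : 0 < INR k by apply: lt_0_INR; apply/ltP.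
have kn' : INR k < INR n by apply: lt_INR; apply/ltP.
apply: (Rmult_lt_reg_l _ _ _ s0); rewrite Rmult_0_r cheb_sin.
apply: sin_gt_0.
  by apply: Rmult_lt_0_compat => //; apply: Rdiv_lt_0_compat; lra.
apply: (Rmult_lt_reg_r (INR n)); first lra.
have e : PI / INR n * INR n = PI by field; lra.
by rewrite Rmult_assoc e; nra.
Qed.

Lemma cheb_n : cheb (2 * cos (PI / INR n)) n = 0.
Proof.
have s0 := sin_PI_div_gt0.
apply: (Rmult_eq_reg_l (sin (PI / INR n))); last lra.
rewrite cheb_sin Rmult_0_r -sin_PI; congr sin; field; lra.
Qed.

Lemma cheb_pred_n : cheb (2 * cos (PI / INR n)) n.-1 = 1.
Proof.
have s0 := sin_PI_div_gt0.
apply: (Rmult_eq_reg_l (sin (PI / INR n))); last lra.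
rewrite cheb_sin Rmult_1_r.
have -> : INR n.-1 * (PI / INR n) = PI - PI / INR n.
  have -> : INR n.-1 = INR n - 1 by rewrite -[in RHS](prednK (ltnW n_gt1)) S_INR; ring.
  field; lra.
by rewrite sin_minus sin_PI cos_PI; ring.
Qed.

End Angle.
End Chebyshev.

(** * Roots of rank two and positivity *)

Section Alternating.
Variable X : Type.
Implicit Types s t : X.

(* alt s t k ends in t, and nxt s t k is the letter that extends it on the left. *)
Definition nxt s t k := if odd k then s else t.

Fixpoint alt s t k : seq X :=
  if k is k1.+1 then nxt s t k1 :: alt s t k1 else [::].

Lemma size_alt s t k : size (alt s t k) = k.
Proof. by elim: k => //= k ->. Qed.

Lemma nxtSS s t k : nxt s t k.+2 = nxt s t k.
Proof. by rewrite /nxt /= negbK. Qed.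

Lemma nxtS s t k : nxt s t k.+1 = nxt t s k.
Proof. by rewrite /nxt /=; case: odd. Qed.

Lemma alt_rcons s t k : alt s t k.+1 = alt t s k ++ [:: t].
Proof.
elim: k s t => [|k IH] s t //.
have -> : alt s t k.+2 = nxt s t k.+1 :: alt s t k.+1 by [].
by rewrite IH nxtS.
Qed.

Lemma PiL_rcons s t k : PiL t s k.+1 = rcons (PiL t s k) (nxt s t k).
Proof.
elim: k s t => [|k IH] s t //.
have -> : PiL t s k.+2 = t :: PiL s t k.+1 by [].
by rewrite IH nxtS.
Qed.

Lemma PiRE s t k : PiR s t k = alt s t k.
Proof. by rewrite /PiR; elim: k => // k IH; rewrite PiL_rcons rev_rcons IH. Qed.

End Alternating.

Lemma map_alt (X Y : Type) (f : X -> Y) s t k :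
  map f (alt s t k) = alt (f s) (f t) k.
Proof. by elim: k => //= k ->; rewrite /nxt; case: odd. Qed.

(** Equality in W on words without signs; the generators are involutions, so inverse letters can be
    dispensed with. *)
Inductive coxeq (S : Type) (m : S -> S -> option nat) : seq S -> seq S -> Prop :=
| coxeq_braid u v s t k : s <> t -> m s t = Some k ->
    coxeq m (u ++ alt s t k ++ v) (u ++ alt t s k ++ v)
| coxeq_sq u v s : coxeq m (u ++ [:: s; s] ++ v) (u ++ v)
| coxeq_refl w : coxeq m w w
| coxeq_sym w1 w2 : coxeq m w1 w2 -> coxeq m w2 w1
| coxeq_trans w1 w2 w3 : coxeq m w1 w2 -> coxeq m w2 w3 -> coxeq m w1 w3.

#[global] Instance coxeq_equiv (S : Type) (m : S -> S -> option nat) :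
  Equivalence (coxeq m).
Proof.
by split; [exact: coxeq_refl | exact: coxeq_sym | exact: coxeq_trans].
Qed.

#[global] Instance coxeq_cat (S : Type) (m : S -> S -> option nat) :
  Proper (coxeq m ==> coxeq m ==> coxeq m) cat.
Proof.
have ctx a b u v : coxeq m u v -> coxeq m (a ++ u ++ b) (a ++ v ++ b).
  elim=> {u v} [u v s t k nst mst|u v s|w|u v _ IH|u v w _ IH1 _ IH2].
  - by have := coxeq_braid (a ++ u) (v ++ b) nst mst; rewrite -!catA.
  - by have := coxeq_sq m (a ++ u) (v ++ b) s; rewrite -!catA.
  - exact: coxeq_refl.
  - exact: coxeq_sym.
  - exact: coxeq_trans IH1 IH2.
move=> u u' eu v v' ev; apply: (coxeq_trans (w2 := u' ++ v)).
  by have := ctx [::] v _ _ eu.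
by have := ctx u' [::] _ _ ev; rewrite !cats0.
Qed.

(** * The action of W on V and its dihedral subgroups *)

Section Geometry.
Local Open Scope R_scope.
Variables (S : eqType) (m : S -> S -> option nat) (Hm : coxeter_matrix m).
Implicit Types (s t x : S) (u v w : seq S) (V : lincomb S).

Lemma cox_form_diag s : cox_form m s s = 2.
Proof.
case: Hm => m1 _; rewrite /cox_form m1 /=.
by rewrite (_ : PI / 1 = PI) ?cos_PI; [lra | field].
Qed.

Lemma cox_form_sym s t : cox_form m s t = cox_form m t s.
Proof. by case: Hm => _ [mC _]; rewrite /cox_form mC. Qed.

Lemma coef2 s t a b x : coef [:: (s, a); (t, b)] x =
  (if s == x then a else 0) + (if t == x then b else 0).
Proof. by rewrite /=; lra. Qed.

Lemma refl_refl s V :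
  coef (refl_simple m s (refl_simple m s V)) =1 coef V.
Proof.
move=> x; rewrite !coef_refl !form_simpleE lin_refl cox_form_diag form_simpleE.
by case: eqP => _; lra.
Qed.

Section Rank2.
Variables s t : S.
Hypothesis nst : s <> t.

Definition chb := cheb (- cox_form m s t).

(** Vacuous when m_(s,t) is infinite, so that one bound covers both cases. *)
Definition below_mst (r : nat -> nat -> bool) k := forall n, m s t = Some n -> r k n.

Let m_gt1 n : m s t = Some n -> (1 < n)%N.
Proof. by case: Hm => _ [_ m2] /m2; apply. Qed.

Lemma below_mst_succ k :
  below_mst ltn k -> below_mst ltn k.+1 \/ m s t = Some k.+1.
Proof.
move=> bk; case mst: (m s t) => [n|]; last by left=> n; rewrite mst.
move: (bk _ mst : (k < n)%N); rewrite leq_eqVlt => /orP[/eqP <-|kn]; first by right.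
by left=> n'; rewrite mst => -[<-].
Qed.

Lemma chbE n : m s t = Some n -> chb =1 cheb (2 * cos (PI / INR n)).
Proof.
by move=> mst k; rewrite /chb /cox_form mst; congr cheb; lra.
Qed.

Lemma chb_gt0 k : (0 < k)%N -> below_mst ltn k -> 0 < chb k.
Proof.
move=> k0 bk; case mst: (m s t) => [n|].
  by rewrite (chbE mst); apply: cheb_gt0 => //; [exact: m_gt1 | exact: bk].
rewrite /chb /cox_form mst Ropp_involutive cheb2.
by apply: lt_0_INR; apply/ltP.
Qed.

Lemma chb_n n : m s t = Some n -> chb n = 0.
Proof. by move=> mst; rewrite (chbE mst) cheb_n //; apply: m_gt1. Qed.

Lemma chb_pred_n n : m s t = Some n -> chb n.-1 = 1.
Proof. by move=> mst; rewrite (chbE mst) cheb_pred_n //; apply: m_gt1. Qed.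

Lemma chb_ge0 k : below_mst leq k -> 0 <= chb k.
Proof.
move=> bk; case: k bk => [|k] bk; first exact: Rle_refl.
case mst: (m s t) => [n|]; last first.
  by apply/Rlt_le/chb_gt0 => // n; rewrite mst.
have := bk _ mst; rewrite leq_eqVlt => /orP[/eqP -> | kn].
  by rewrite (chb_n mst); apply: Rle_refl.
by apply/Rlt_le/chb_gt0 => // n'; rewrite mst => -[<-].
Qed.

(** The reflection in [nxt s t k] changes only the coefficient [chb k], which becomes [chb k.+2] by
    the Chebyshev recurrence. *)
Lemma alt_root k : coef (act_word m (alt s t k) [:: (s, 1)]) =1
  coef [:: (nxt s t k.+1, chb k.+1); (nxt s t k, chb k)].
Proof.
elim: k => [|k IH] x; first by rewrite coef2 /chb /nxt /=; case: eqP; case: eqP; lra.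
rewrite [alt _ _ _]/= [act_word _ _ _]/= coef_refl IH.
rewrite form_simpleE (lin_ext _ IH) /= cox_form_diag nxtSS.
have -> : cox_form m (nxt s t k.+1) (nxt s t k) = cox_form m s t.
  by rewrite /nxt /=; case: odd => //=; rewrite cox_form_sym.
have -> : chb k.+2 = - cox_form m s t * chb k.+1 - chb k by rewrite /chb chebSS.
by case: eqP => _; case: eqP => _; lra.
Qed.

End Rank2.

(** Both sides are the negative of one simple root. On the left this is read off the Chebyshev
    numbers; on the right the last letter s negates alpha_s, and the remaining word of length n - 1
    sends alpha_s to a simple root. *)
Lemma rootvec_alt_longest s t n : s <> t -> m s t = Some n ->
  rootvec m (alt s t n) s =1 rootvec m (alt t s n) s.
Proof.
move=> nst mst x; case: Hm => _ [mC m2].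
case: n mst => [/(m2 _ _ _ nst) //|n mst].
rewrite /rootvec alt_root // coef2 alt_rcons act_cat.
have ns : coef (act_word m [:: s] [:: (s, 1)]) =1 coef [:: (s, -1)].
  by move=> y; rewrite /= cox_form_diag; case: eqP => _; lra.
rewrite (act_ext _ _ ns) coef_act /=.
have -> : rootvec m (alt s t n) s x = coef [:: (nxt s t n, 1)] x.
  rewrite /rootvec alt_root // coef2 /= (chb_n nst mst).
  by rewrite (chb_pred_n nst mst); case: eqP; case: eqP; lra.
have -> : chb s t n.+2 = -1.
  rewrite /chb chebSS -/(chb s t n.+1) -/(chb s t n).
  by rewrite (chb_n nst mst) (chb_pred_n nst mst : chb s t n = 1); lra.
by rewrite (chb_n nst mst) nxtSS /=; case: eqP; case: eqP; lra.
Qed.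

Lemma act_orthogonal w V : {in w, forall s, form_simple m V s = 0} ->
  coef (act_word m w V) =1 coef V.
Proof.
elim: w => //= s w IH Vw x.
have {}IH : coef (act_word m w V) =1 coef V.
  by apply: IH => y yw; apply: Vw; rewrite inE yw orbT.
rewrite coef_refl IH form_simpleE (lin_ext _ IH) -form_simpleE.
by rewrite Vw ?inE ?eqxx //; case: eqP; lra.
Qed.

Lemma alt_sub s t k : {subset alt s t k <= [:: s; t]}.
Proof.
elim: k => //= k IH x; rewrite inE => /orP[/eqP->|/IH//].
by rewrite /nxt !inE; case: odd; rewrite eqxx ?orbT.
Qed.

(* The form is nondegenerate on the span of two simple roots with m_(s,t)
   finite, so a vector is the sum of its projection on that span and of a
   vector fixed by both reflections. *)
Lemma rootvec_braid s t n z : s <> t -> m s t = Some n ->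
  rootvec m (alt s t n) z =1 rootvec m (alt t s n) z.
Proof.
move=> nst mst x; case: (Hm) => _ [mC m2]; have n1 := m2 _ _ _ nst mst.
set c := cox_form m s t.
have c4 : 4 - c * c <> 0.
  have := sin_PI_div_gt0 n1; have := sin2_cos2 (PI / INR n).
  by rewrite /c /cox_form mst /Rsqr; nra.
pose p := cox_form m z s; pose q := cox_form m z t.
(* [a] and [b] solve the linear system making [V] orthogonal to alpha_s and alpha_t; its determinant
   [4 - c * c] is 4 sin^2 (PI / n). *)
pose a := (2 * p - c * q) / (4 - c * c).
pose b := (2 * q - c * p) / (4 - c * c).
pose V := [:: (z, 1); (s, - a); (t, - b)].
have Vs : form_simple m V s = 0.
  rewrite /V /= cox_form_diag (cox_form_sym t s) -/c -/p /a /b; field; lra.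
have Vt : form_simple m V t = 0.
  rewrite /V /= cox_form_diag -/c -/q /a /b; field; lra.
have fixV w : {subset w <= [:: s; t]} ->
  rootvec m w z x = coef V x + a * rootvec m w s x + b * rootvec m w t x.
  move=> ws; have Vw : {in w, forall y, form_simple m V y = 0}.
    by move=> y /ws; rewrite !inE => /orP[] /eqP ->.
  by rewrite -(act_orthogonal Vw) coef_act /=; lra.
rewrite !fixV ?(rootvec_alt_longest nst mst).
- have nts : t <> s by move=> ?; apply: nst.
  by rewrite (rootvec_alt_longest nts) // mC.
- by move=> y /alt_sub; rewrite !inE orbC.
- exact: alt_sub.
Qed.

Lemma coxeq_act u v V : coxeq m u v ->
  coef (act_word m u V) =1 coef (act_word m v V).
Proof.
move=> uv; elim: uv V => {u v} [u v s t n nst mst|u v s|//|u v _ IH|u v w _ IH1 _ IH2] V x.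
- rewrite !act_cat; apply: act_ext => {}x.
  by rewrite !coef_act; apply: eq_lin => z; apply: rootvec_braid.
- by rewrite !act_cat; apply: act_ext; apply: refl_refl.
- by rewrite IH.
- by rewrite IH1 IH2.
Qed.

Lemma coxeq_rootvec u v s : coxeq m u v -> rootvec m u s =1 rootvec m v s.
Proof. exact: coxeq_act. Qed.

Lemma coxeq_rev w : coxeq m (rev w ++ w) [::].
Proof.
elim: w => [|a w IH]; first exact: coxeq_refl.
rewrite rev_cons cat_rcons; apply: coxeq_trans IH.
exact: (coxeq_sq _ (rev w) w).
Qed.

(** The words [alt s t k] with k below m_(s,t) do not end in s and represent the left cosets of the
    subgroup generated by s. The induction multiplies on the left by one letter, which extends the
    alternating word or cancels its first letter. *)
Lemma dihedral_normal_form s t u : s <> t -> {subset u <= [:: s; t]} ->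
  exists2 k, below_mst s t ltn k &
    (coxeq m u (alt s t k) /\ (k <= size u)%N) \/
    (coxeq m u (alt s t k ++ [:: s]) /\ (k < size u)%N).
Proof.
move=> nst; case: (Hm) => _ [mC m2].
elim: u => [|a u IH] ust.
  exists 0%N; last by left; split=> //; apply: coxeq_refl.
  by move=> n /(m2 _ _ _ nst) /ltnW.
have {IH} [|k bk IH] := IH; first by move=> y yu; apply: ust; rewrite inE yu orbT.
have cons_eq w : coxeq m u w -> coxeq m (a :: u) (a :: w).
  by move=> uw; apply: (coxeq_cat (coxeq_refl m [:: a]) uw).
(* At full length the braid relation gives the alternating word ending in s, which switches between
   the two forms. *)
have longest : m s t = Some k.+1 -> coxeq m (alt s t k.+1) (alt s t k ++ [:: s]).
  move=> mst; rewrite -alt_rcons.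
  by have := coxeq_braid [::] [::] nst mst; rewrite /= !cats0.
have k_lt := below_mst_succ bk.
have sq w : coxeq m (a :: a :: w) w := coxeq_sq m [::] w a.
have [ak|ak] : a = nxt s t k \/ a = nxt s t k.+1.
- have := ust a; rewrite !inE eqxx /nxt /= => /(_ isT) /orP[] /eqP ->.
    by case: odd; [left | right].
  by case: odd; [right | left].
- have e : a :: alt s t k = alt s t k.+1 by rewrite ak.
  case: k_lt => [bk1|/longest {}longest].
    exists k.+1 => //; case: IH => -[/cons_eq uk ks]; [left | right].
      by rewrite -e.
    by rewrite -e.
  exists k => //; case: IH => -[/cons_eq uk ks]; [right | left]; split=> //.
  + by apply: coxeq_trans uk _; rewrite e.
  + apply: coxeq_trans uk _; rewrite -cat_cons e.
    apply: coxeq_trans (coxeq_cat longest (coxeq_refl _ _)) _.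
    by have := coxeq_sq m (alt s t k) [::] s; rewrite !cats0 -catA.
  + exact: leq_trans (ltnW ks) (leqnSn _).
(* Here [a] cancels the first letter; for k = 0 there is none, [a] is s, and the two forms are
   exchanged. *)
- case: k => [|k] in bk IH k_lt longest ak *.
    have {}ak : a = s by [].
    exists 0%N => //; case: IH => -[/cons_eq uk ks]; [right | left]; split=> //.
      by rewrite ak in uk *.
    by apply: coxeq_trans uk _; rewrite -ak; apply: sq.
  exists k; first by move=> n /bk /ltnW.
  rewrite nxtSS in ak.
  have e : alt s t k.+1 = a :: alt s t k by rewrite ak.
  rewrite e in IH; case: IH => -[/cons_eq uk ks]; [left | right]; split.
  + exact: coxeq_trans uk (sq _).
  + exact: leq_trans (ltnW ks) (leqnSn _).
  + exact: coxeq_trans uk (sq _).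
  + exact: leq_trans (ltnW ks) (leqnSn _).
Qed.

(** * Positive roots and shortening of words *)

Definition positive w s := forall x, 0 <= rootvec m w s x.

(** Sizes of words replace the length function of W; [w] need not be reduced, so [positive w s] may
    hold as well. *)
Definition shortens w s := exists2 w', coxeq m (w ++ [:: s]) w' & (size w' < size w)%N.

(** While a letter a in {s, t} shortens v, it is moved across: v u = (v a)(a u). The dichotomy
    enters as a hypothesis up to size n because its own inductive proof uses this lemma. *)
Lemma coset_decomposition n s t v u : {subset u <= [:: s; t]} -> (size v <= n)%N ->
  (forall v', (size v' <= n)%N -> positive v' s \/ shortens v' s) ->
  (forall v', (size v' <= n)%N -> positive v' t \/ shortens v' t) ->
  exists v' u', [/\ coxeq m (v ++ u) (v' ++ u'), {subset u' <= [:: s; t]},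
    (size v' + size u' <= size v + size u)%N, (size v' <= size v)%N &
    positive v' s /\ positive v' t].
Proof.
move=> ust vn Hs Ht; have [N] := ubnP (size v).
elim: N => // N IH in v u ust vn *; rewrite ltnS => vN.
have step a : a \in [:: s; t] -> shortens v a -> exists v' u',
    [/\ coxeq m (v ++ u) (v' ++ u'), {subset u' <= [:: s; t]},
    (size v' + size u' <= size v + size u)%N, (size v' <= size v)%N &
    positive v' s /\ positive v' t].
  move=> ast [w vw wv].
  have [||| v' [u' [e u'st sz sz' pst]]] := IH w (a :: u).
  - by move=> y; rewrite inE => /orP[/eqP -> | /ust].
  - exact: leq_trans (ltnW wv) vn.
  - exact: leq_trans wv vN.
  exists v', u'; split=> //.
  - apply: coxeq_trans e; rewrite -cat_rcons -cats1.
    apply: coxeq_trans (coxeq_cat (coxeq_cat vw (coxeq_refl _ [:: a])) (coxeq_refl _ u)).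
    by apply: coxeq_sym; rewrite -!catA; apply: coxeq_sq.
  - by apply: leq_trans sz _; rewrite /= addnS -addSn leq_add2r.
  - exact: leq_trans sz' (ltnW wv).
have [ps|/step] := Hs _ vn; last by apply; rewrite !inE eqxx.
have [pt|/step] := Ht _ vn; last by apply; rewrite !inE eqxx orbT.
by exists v, u; split=> //; apply: coxeq_refl.
Qed.

(** Strong induction on the size. If the last letter is t other than s, write the word as v u with u
    in the dihedral group of s and t. If u is alternating and ends in t, the root is a nonnegative
    combination of v(alpha_s) and v(alpha_t); otherwise u ends in s, which cancels. *)
Lemma positive_or_shortens w s : positive w s \/ shortens w s.
Proof.
have [n] := ubnP (size w); elim: n => // n IH in w s *.
case/lastP: w => [|w t]; rewrite ?size_rcons ltnS => wn.
  by left=> x; rewrite rootvec_nil; case: eqP; lra.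
have [<-|/eqP nst] := eqVneq s t.
  right; exists w; last by rewrite size_rcons.
  by have := coxeq_sq m w [::] s; rewrite !cats0 -cats1 -catA.
have [||v'|v'|v [u [e ust sz _ [ps pt]]]] := @coset_decomposition (size w) s t w [:: t].
- by move=> y; rewrite !inE => ->; rewrite orbT.
- by [].
- by move=> v'w; apply: IH; apply: leq_ltn_trans v'w wn.
- by move=> v'w; apply: IH; apply: leq_ltn_trans v'w wn.
rewrite cats1 in e.
have [k bk [] [uk ks]] := dihedral_normal_form nst ust.
  left=> x; rewrite (coxeq_rootvec _ e) rootvec_cat.
  rewrite (lin_ext _ (coxeq_act _ uk)) (lin_ext _ (alt_root s t k)) /=.
  have c1 : 0 <= chb s t k.+1 by apply: chb_ge0.
  have c0 : 0 <= chb s t k by apply: chb_ge0 => // n' /bk /ltnW.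
  suff: 0 <= rootvec m v (nxt s t k.+1) x /\ 0 <= rootvec m v (nxt s t k) x by nra.
  by rewrite /nxt; split; case: odd.
right; exists (v ++ alt s t k).
  apply: coxeq_trans (coxeq_cat e (coxeq_refl _ [:: s])) _; rewrite -catA.
  apply: coxeq_cat; first exact: coxeq_refl.
  apply: coxeq_trans (coxeq_cat uk (coxeq_refl _ [:: s])) _; rewrite -catA.
  by have := coxeq_sq m (alt s t k) [::] s; rewrite !cats0.
rewrite size_cat size_alt size_rcons; apply: leq_trans (_ : size v + size u <= _)%N.
  by rewrite ltn_add2l.
by rewrite addn1 in sz.
Qed.

Lemma act_rev w V : coef (act_word m (rev w) (act_word m w V)) =1 coef V.
Proof. by move=> x; rewrite -act_cat (coxeq_act _ (coxeq_rev w)). Qed.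

(** The word [w] acts invertibly, with inverse [rev w], so the relation pulls back to simple
    roots. *)
Lemma rootvec_independent w s t a b : s <> t ->
  (forall x, a * rootvec m w s x + b * rootvec m w t x = 0) -> a = 0 /\ b = 0.
Proof.
move=> nst ab; pose V := [:: (s, a); (t, b)].
have V0 x : coef V x = 0.
  rewrite -(act_rev w) coef_act lin_eq0 // => y; rewrite coef_act /=.
  by have := ab y; lra.
have := V0 s; have := V0 t; rewrite !coef2 !eqxx.
by case: eqP => // _; case: eqP => [/esym//|_]; lra.
Qed.

End Geometry.

(** * Conjugation of the generators in VA *)

Section Presentation.
Variables (X : Type) (Rel : word X -> word X -> Prop).
Implicit Types u v w : word X.

#[global] Instance pres_eq_equiv : Equivalence (pres_eq Rel).
Proof. by split; [exact: pe_refl | exact: pe_sym | exact: pe_trans]. Qed.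

#[global] Instance pres_eq_cat :
  Proper (pres_eq Rel ==> pres_eq Rel ==> pres_eq Rel) cat.
Proof.
have ctx a b u v : pres_eq Rel u v -> pres_eq Rel (a ++ u ++ b) (a ++ v ++ b).
  elim=> {u v} [l r u v lr|x c u v|w|u v _ IH|u v w _ IH1 _ IH2].
  - by have := pe_rel (a ++ u) (v ++ b) lr; rewrite -!catA.
  - by have := pe_free Rel x c (a ++ u) (v ++ b); rewrite -!catA.
  - exact: pe_refl.
  - exact: pe_sym.
  - exact: pe_trans IH1 IH2.
move=> u u' eu v v' ev; apply: (pe_trans (w2 := u' ++ v)).
  by have := ctx [::] v _ _ eu.
by have := ctx u' [::] _ _ ev; rewrite !cats0.
Qed.

Lemma inv_wordK : involutive (@inv_word X).
Proof.
move=> u; rewrite /inv_word map_rev revK -map_comp -[RHS]map_id.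
by apply: eq_map => -[x b] /=; rewrite negbK.
Qed.

Lemma inv_word_cat u v : inv_word (u ++ v) = inv_word v ++ inv_word u.
Proof. by rewrite /inv_word map_cat rev_cat. Qed.

Lemma pres_eq_invr u : pres_eq Rel (u ++ inv_word u) [::].
Proof.
elim: u => [|[x b] u IH]; first exact: pe_refl.
rewrite -[in inv_word _]cat1s inv_word_cat -cat1s -catA (catA u) IH.
exact: (pe_free Rel x b [::] [::]).
Qed.

Lemma pres_eq_invl u : pres_eq Rel (inv_word u ++ u) [::].
Proof. by have := pres_eq_invr (inv_word u); rewrite inv_wordK. Qed.

Lemma pres_eq_cancell w u v : pres_eq Rel (w ++ u) (w ++ v) -> pres_eq Rel u v.
Proof.
move=> uv; rewrite -[u]cat0s -[v]cat0s -(pres_eq_invl w) -!catA uv; reflexivity.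
Qed.

Lemma pres_eq_cancelr w u v : pres_eq Rel (u ++ w) (v ++ w) -> pres_eq Rel u v.
Proof.
move=> uv; rewrite -[u]cats0 -[v]cats0 -(pres_eq_invr w) !catA uv; reflexivity.
Qed.

End Presentation.

Section Extend.
Variables (X Y : Type) (f : X -> word Y).

Lemma extend_word_cat u v :
  extend_word f (u ++ v) = extend_word f u ++ extend_word f v.
Proof. by rewrite /extend_word map_cat flatten_cat. Qed.

Lemma extend_word_cons p u :
  extend_word f (p :: u) = (if p.2 then inv_word (f p.1) else f p.1) ++ extend_word f u.
Proof. by []. Qed.

Lemma pres_eq_extend (R1 : word X -> word X -> Prop) (R2 : word Y -> word Y -> Prop) :
  (forall l r, R1 l r -> pres_eq R2 (extend_word f l) (extend_word f r)) ->
  forall u v, pres_eq R1 u v -> pres_eq R2 (extend_word f u) (extend_word f v).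
Proof.
move=> R12 u v; elim=> {u v} [l r u v lr|x b u v|w|u v _ IH|u v w _ IH1 _ IH2].
- by rewrite !extend_word_cat (R12 _ _ lr); reflexivity.
- rewrite !extend_word_cat !extend_word_cons /= cats0.
  by case: b => /=; rewrite ?pres_eq_invl ?pres_eq_invr; reflexivity.
- exact: pe_refl.
- exact: pe_sym.
- exact: pe_trans IH1 IH2.
Qed.

(** The word [c] is carried through one letter at a time; this turns a braid word in conjugates into
    the conjugate of a braid word. *)
Lemma extend_alt_conj (R2 : word Y -> word Y -> Prop) c x y a b k :
  pres_eq R2 (f x ++ c) (c ++ [:: (a, false)]) ->
  pres_eq R2 (f y ++ c) (c ++ [:: (b, false)]) ->
  pres_eq R2 (extend_word f (pos_word (alt x y k)) ++ c) (c ++ pos_word (alt a b k)).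
Proof.
move=> xa yb; elim: k => [|k IH]; first by rewrite cats0; apply: pe_refl.
rewrite /= extend_word_cons /= -catA IH catA.
rewrite -[(nxt a b k, false) :: _]cat1s [c ++ [:: _] ++ _]catA.
by rewrite /nxt; case: odd; rewrite ?xa ?yb; reflexivity.
Qed.

End Extend.

Section Virtual.
Variables (S : eqType) (m : S -> S -> option nat) (Hm : coxeter_matrix m).
Implicit Types (s t : S) (p w : seq S) (g h : word (S + S)).

Notation "g =VA h" := (pres_eq (va_rel m) g h) (at level 70).

Definition sigma_word s : word (S + S) := [:: (inl s, false)].

Lemma tau_word_cat u w : tau_word (u ++ w) = tau_word u ++ tau_word w.
Proof. by rewrite /tau_word /pos_word !map_cat. Qed.

Lemma tau_sq s : tau_word [:: s; s] =VA [::].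
Proof.
have := @pe_rel _ (va_rel m) (tau_word [:: s; s]) [::] [::] [::].
by apply; right; exists s.
Qed.

#[global] Instance tau_word_proper :
  Proper (coxeq m ==> pres_eq (va_rel m)) (@tau_word S).
Proof.
move=> u v; elim=> {u v} [u v s t k nst mst|u v s|w|u v _ IH|u v w _ IH1 _ IH2].
- rewrite !tau_word_cat; apply/pe_sym/pe_rel; left; exists s, t, k.
  by split=> //; split=> //; right; left; rewrite /tau_word !map_alt !PiRE; split.
- by rewrite !tau_word_cat tau_sq; reflexivity.
- reflexivity.
- exact: pe_sym.
- exact: pe_trans IH1 IH2.
Qed.

(** Relation (v3): the word has length m_(s,t) - 1, and [nxt s t k] is the letter r. *)
Lemma sigma_alt s t k : s <> t -> m s t = Some k.+1 ->
  tau_word (alt s t k) ++ sigma_word s =VA sigma_word (nxt s t k) ++ tau_word (alt s t k).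
Proof.
move=> nst mst.
have := @pe_rel _ (va_rel m) (tau_word (alt s t k) ++ sigma_word s)
  (sigma_word (nxt s t k) ++ tau_word (alt s t k)) [::] [::].
rewrite !cats0; apply; left; exists s, t, k.+1; split=> //; split=> //; right; right.
rewrite /= PiRE -map_alt /tau_word /sigma_word /pos_word map_cat; split=> //.
by rewrite /nxt; case: odd.
Qed.

Local Open Scope R_scope.

Lemma sigma_conj w s t : rootvec m w s =1 rootvec m [::] t ->
  tau_word w ++ sigma_word s =VA sigma_word t ++ tau_word w.
Proof.
have [n] := ubnP (size w); elim: n => // n IH in w s *.
have transport w' s' w0 : coxeq m w0 w' -> (size w' < n)%N ->
    rootvec m w0 s' =1 rootvec m [::] t ->
    tau_word w0 ++ sigma_word s' =VA sigma_word t ++ tau_word w0.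
  move=> e w'n rt; rewrite e; apply: IH => // x; rewrite -rt.
  by rewrite (coxeq_rootvec Hm _ e).
have tt : rootvec m [::] t t = 1 by rewrite rootvec_nil eqxx.
case/lastP: w => [|w r]; rewrite ?size_rcons ltnS => wn rt.
  have := rt t; rewrite !rootvec_nil eqxx; case: eqP => [->|] _; last lra.
  by rewrite cats0; reflexivity.
have [rs|/eqP nrs] := eqVneq r s.
  (* Without its last letter s the word sends alpha_s to -alpha_t, so it is not positive and the
     full word has a shorter form. *)
  have neg x : rootvec m (rcons w r) s x = - rootvec m w s x.
    by rewrite -cats1 rootvec_cat rs /= cox_form_diag //; lra.
  have [pos|[w' ww' ltw]] := positive_or_shortens Hm w s.
    by have := pos t; have := neg t; rewrite rt tt; lra.
  by apply: transport rt; [rewrite -cats1 rs; apply: ww' | apply: ltn_trans wn].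
have nsr : s <> r by move=> sr; apply: nrs.
have [||v' _|v' _|v [u [e ust sz vw [ps pr]]]] :=
    @coset_decomposition _ m (size w) s r w [:: r].
- by move=> y; rewrite !inE => ->; rewrite orbT.
- by [].
- exact: positive_or_shortens.
- exact: positive_or_shortens.
rewrite cats1 in e.
have {}vw : (size v < n)%N by apply: leq_ltn_trans wn.
have [k bk uk] := dihedral_normal_form Hm nsr ust.
have c1 : 0 <= chb m s r k.+1 by apply: chb_ge0.
have c0 : 0 <= chb m s r k by apply: chb_ge0 => // n' /bk /ltnW.
have pnxt j x : 0 <= rootvec m v (nxt s r j) x by rewrite /nxt; case: odd.
have alt_rt x : rootvec m (v ++ alt s r k) s x =
    chb m s r k.+1 * rootvec m v (nxt s r k.+1) x +
    chb m s r k * rootvec m v (nxt s r k) x.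
  by rewrite rootvec_cat (lin_ext _ (alt_root Hm s r k)) /=; lra.
(* If u ended in s, the image of alpha_s would have only nonpositive coordinates, while alpha_t has
   coordinate 1. *)
case: uk => -[uk _]; last first.
  have := rt t; rewrite tt (coxeq_rootvec Hm _ e) rootvec_cat.
  rewrite (lin_ext _ (coxeq_act Hm _ uk)) act_cat.
  have ns : coef (act_word m [:: s] [:: (s, 1)]) =1 coef [:: (s, -1)].
    by move=> y; rewrite /= cox_form_diag //; case: eqP => _; lra.
  rewrite (lin_ext _ (act_ext _ _ ns)) lin_act /=.
  have := alt_rt t; rewrite rootvec_cat => ->.
  by have := pnxt k t; have := pnxt k.+1 t; nra.
have {}e : coxeq m (rcons w r) (v ++ alt s r k).
  by apply: coxeq_trans e _; apply: coxeq_cat uk; apply: coxeq_refl.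
have {}rt x : rootvec m (v ++ alt s r k) s x = rootvec m [::] t x.
  by rewrite -rt (coxeq_rootvec Hm _ e).
rewrite e; case: k => [|k] in bk uk e c0 c1 alt_rt rt *.
  by rewrite cats0 in rt *; apply: IH.
(* If u is shorter than m_(s,r) - 1, both coefficients are positive. Then v(alpha_s) and v(alpha_r)
   are both multiples of alpha_t, against their independence. *)
case: (below_mst_succ bk) => [bk1|mk].
  have cp1 : 0 < chb m s r k.+2 by apply: chb_gt0.
  have cp0 : 0 < chb m s r k.+1 by apply: chb_gt0.
  have off x : x <> t -> rootvec m v s x = 0 /\ rootvec m v r x = 0.
    move=> xt; have := alt_rt x; rewrite rt rootvec_nil; case: eqP => [/esym//|_].
    have := pnxt k.+1 x; have := pnxt k.+2 x; rewrite nxtSS /nxt /=.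
    by case: odd => /=; nra.
  have [|r0 s0] := @rootvec_independent _ m Hm v s r (rootvec m v r t) (- rootvec m v s t) nsr.
    by move=> x; have [->|/eqP/off[-> ->]] := eqVneq x t; lra.
  have := alt_rt t; rewrite rt tt nxtSS /nxt /=; case: odd => /=; nra.
(* Now u is the word of (v3). It sends alpha_s to a simple root, which the shorter word v sends to
   alpha_t. *)
rewrite !tau_word_cat -catA (sigma_alt nsr mk) catA IH //.
  by rewrite -catA; reflexivity.
move=> x; rewrite -rt alt_rt (chb_n Hm nsr mk) (chb_pred_n Hm nsr mk : chb m s r k.+1 = 1).
lra.
Qed.

(** Independence of delta_beta from the choice of word and letter: w^{-1} u sends alpha_s to
    alpha_t, so [sigma_conj] applies to it. *)
Lemma sigma_conj_eq u s w t : rootvec m u s =1 rootvec m w t ->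
  tau_word u ++ sigma_word s ++ inv_word (tau_word u) ++ tau_word w =VA tau_word w ++ sigma_word t.
Proof.
move=> ut; have rt : rootvec m (rev w ++ u) s =1 rootvec m [::] t.
  move=> x; rewrite rootvec_cat.
  have e : coef (act_word m u [:: (s, 1)]) =1 coef (act_word m w [:: (t, 1)]) := ut.
  by rewrite (lin_ext _ e) -rootvec_cat (coxeq_rootvec Hm _ (coxeq_rev m w)).
apply: (pres_eq_cancell (w := tau_word (rev w))).
rewrite !catA -!tau_word_cat (sigma_conj rt) (coxeq_rev m w) tau_word_cat.
rewrite -!catA (catA (tau_word u)) pres_eq_invr cat0s -tau_word_cat (coxeq_rev m w).
reflexivity.
Qed.

End Virtual.

(** * The semidirect decomposition *)

Section Scan.
Local Open Scope R_scope.
Variables (S : eqType) (m : S -> S -> option nat) (Hm : coxeter_matrix m).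
Implicit Types (s t : S) (p q w : seq S) (g h : word (S + S)).

Notation "g =VA h" := (pres_eq (va_rel m) g h) (at level 70).
Notation "u =hat v" := (pres_eq (hat_artin_rel (m := m)) u v) (at level 70).

Definition root_of p s : roots_of m :=
  exist (is_root m) (rootvec m p s)
    (ex_intro _ p (ex_intro (fun t => rootvec m p s = rootvec m p t) s erefl)).

Lemma root_of_eq p q s t : rootvec m p s =1 rootvec m q t -> root_of p s = root_of q t.
Proof. by move=> e; apply/subset_eq_compat/functional_extensionality. Qed.

(* The projection VA -> A[hat Gamma] of the decomposition
   VA = A[hat Gamma] x| W, applied after translation by p in W. *)
Fixpoint scan p g : word (roots_of m) :=
  match g with
  | [::] => [::]
  | (inl s, b) :: g1 => (root_of p s, b) :: scan p g1
  | (inr s, _) :: g1 => scan (p ++ [:: s]) g1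
  end.

Definition letters g : seq S := map fst (piK_word g).

Lemma piK_word_cat g h : piK_word (g ++ h) = piK_word g ++ piK_word h.
Proof. by rewrite /piK_word map_cat flatten_cat. Qed.

(** The cocycle rule of a projection from a semidirect product. *)
Lemma scan_cat p g h : scan p (g ++ h) = scan p g ++ scan (p ++ letters g) h.
Proof.
elim: g p => [|[[s|s] b] g IH] p /=; first by rewrite cats0.
  by rewrite IH.
by rewrite IH -catA.
Qed.

Lemma scan_ext p q g : coxeq m p q -> scan p g = scan q g.
Proof.
elim: g p q => [|[[s|s] b] g IH] p q pq //=.
  by rewrite (IH _ _ pq); congr ((_, _) :: _); apply/root_of_eq/coxeq_rootvec.
by apply: IH; exact: (coxeq_cat pq (coxeq_refl _ _)).
Qed.

Lemma piK_tau w : piK_word (tau_word w) = pos_word w.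
Proof. by elim: w => //= s w <-. Qed.

Lemma letters_tau w : letters (tau_word w) = w.
Proof. by rewrite /letters piK_tau /pos_word -map_comp map_id. Qed.

Lemma piK_inv g : piK_word (inv_word g) = inv_word (piK_word g).
Proof.
elim: g => // x g IH; rewrite -cat1s inv_word_cat !piK_word_cat inv_word_cat IH.
by case: x => -[s|s] b.
Qed.

Lemma letters_inv_tau w : letters (inv_word (tau_word w)) = rev w.
Proof.
by rewrite /letters piK_inv piK_tau /inv_word /pos_word map_rev -!map_comp map_id.
Qed.

Lemma piK_sigmas w : piK_word (pos_word (map inl w)) = [::].
Proof. by elim: w. Qed.

Lemma scan_tau p w : scan p (tau_word w) = [::].
Proof. by elim: w p => //= s w IH p. Qed.

Lemma scan_inv_tau p w : scan p (inv_word (tau_word w)) = [::].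
Proof.
elim: w p => //= s w IH p.
by rewrite -[tau_word _]/(tau_word [:: s] ++ tau_word w) inv_word_cat scan_cat IH.
Qed.

Lemma scan_sigmas p w : scan p (pos_word (map inl w)) = pos_word (map (root_of p) w).
Proof. by elim: w => //= s w ->. Qed.

Lemma root_of_inj p s t : s <> t -> root_of p s <> root_of p t.
Proof.
move=> nst /(congr1 sval) /= e.
have [|one0 _] := @rootvec_independent _ m Hm p s t 1 (-1) nst; last by lra.
by move=> x; rewrite e; lra.
Qed.

Lemma va_rel_piK g h : va_rel m g h -> pres_eq (coxeter_rel m) (piK_word g) (piK_word h).
Proof.
case=> [[s [t [k [nst [mst]]]]]|[s [-> ->]]]; last first.
  have := @pe_rel _ (coxeter_rel m) (pos_word [:: s; s]) [::] [::] [::].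
  by apply; right; exists s.
case=> [[-> ->]|[[-> ->]|[-> ->]]]; rewrite !PiRE -?map_alt.
- by rewrite !piK_sigmas; apply: pe_refl.
- rewrite !piK_tau -[pos_word _]cat0s -[pos_word (alt s t k)]cat0s.
  rewrite -[pos_word _]cats0 -[pos_word (alt s t k)]cats0.
  apply: pe_rel; left; exists s, t, k; do !split=> //; by rewrite PiRE.
- rewrite /pos_word map_cat piK_word_cat cats0; apply: pe_refl.
Qed.

Lemma letters_coxeq u v : pres_eq (coxeter_rel m) u v -> coxeq m (map fst u) (map fst v).
Proof.
have fst_pos w : map fst (pos_word w) = w by rewrite /pos_word -map_comp map_id.
elim=> {u v} [l r u v lr|x b u v|w|u v _ IH|u v w _ IH1 _ IH2].
- rewrite !map_cat; case: lr => [[s [t [k [nst [mst [-> ->]]]]]]|[s [-> ->]]].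
    by rewrite !fst_pos !PiRE; apply/coxeq_sym/coxeq_braid.
  exact: coxeq_sq.
- by rewrite !map_cat; apply: coxeq_sq.
- exact: coxeq_refl.
- exact: coxeq_sym.
- exact: coxeq_trans IH1 IH2.
Qed.

Lemma piK_wordE g : piK_word g =
  extend_word (fun x : S + S => if x is inr s then [:: (s, false)] else [::]) g.
Proof.
rewrite /piK_word /extend_word; congr flatten; apply: eq_map => -[[s|s] b] /=.
  by case: b.
by case: b.
Qed.

Lemma pres_eq_piK g h : g =VA h -> pres_eq (coxeter_rel m) (piK_word g) (piK_word h).
Proof.
rewrite !piK_wordE; apply: pres_eq_extend => l r; rewrite -!piK_wordE.
exact: va_rel_piK.
Qed.

(** Relation (v1) becomes the hat relation between p(alpha_s) and p(alpha_t), and the relations in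
    tau alone become empty. In (v3) each side writes one root, the same since the alternating word
    sends alpha_s to alpha_r. *)
Lemma va_rel_scan p g h : va_rel m g h -> scan p g =hat scan p h.
Proof.
case=> [[s [t [k [nst [mst]]]]]|[s [-> ->]]]; last exact: pe_refl.
case=> [[-> ->]|[[-> ->]|[-> ->]]]; rewrite !PiRE -?map_alt.
- rewrite !scan_sigmas !map_alt -[pos_word _]cat0s -[pos_word (alt (root_of p s) _ k)]cat0s.
  rewrite -[pos_word _]cats0 -[pos_word (alt (root_of p s) _ k)]cats0.
  apply: pe_rel; exists (root_of p s), (root_of p t), p, s, t, k.
  by split; [exact: root_of_inj | rewrite !PiRE].
- by rewrite !scan_tau; apply: pe_refl.
- case: k mst => [|k] mst; first by case: Hm => _ [_ /(_ _ _ _ nst mst)].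
  rewrite /pos_word map_cat scan_cat -/(pos_word _) -/(tau_word _) scan_tau letters_tau /=.
  rewrite -/(pos_word _) -/(tau_word _) scan_tau.
  suff -> : root_of (p ++ alt s t k) s = root_of p (if ~~ odd k then t else s).
    exact: pe_refl.
  apply: root_of_eq => x; rewrite rootvec_cat (lin_ext _ (alt_root Hm s t k)) /=.
  rewrite (chb_n Hm nst mst) (chb_pred_n Hm nst mst : chb m s t k = 1).
  by rewrite /nxt /= if_neg; case: odd => /=; lra.
Qed.

(** The two sides of a relation have the same image in W, so what follows them is scanned from the
    same element. *)
Lemma pres_eq_scan g h : g =VA h -> forall p, scan p g =hat scan p h.
Proof.
elim=> {g h} [l r g h lr|x b g h|w|g h _ IH|g h k _ IH1 _ IH2] p.
- rewrite !scan_cat (va_rel_scan _ lr).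
  rewrite (@scan_ext ((p ++ letters g) ++ letters l) ((p ++ letters g) ++ letters r)) //.
    reflexivity.
  by apply: coxeq_cat; [apply: coxeq_refl | apply/letters_coxeq/va_rel_piK].
- rewrite !scan_cat; case: x => s /=; rewrite ?cats0.
    set q := p ++ letters g.
    exact: (pe_free _ (root_of q s) b (scan p g) (scan q h)).
  rewrite (@scan_ext ((p ++ letters g) ++ [:: s; s]) (p ++ letters g)); first reflexivity.
  by have := coxeq_sq m (p ++ letters g) [::] s; rewrite !cats0.
- reflexivity.
- by apply: pe_sym.
- by apply: pe_trans (IH1 p) (IH2 p).
Qed.

(** * The map from A[hat Gamma] to VA and its left inverse *)

Section Delta.
Variable delta : roots_of m -> word (S + S).
Hypothesis Hdelta : forall beta, is_delta beta (delta beta).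

Lemma delta_conj beta w t : sval beta = rootvec m w t ->
  delta beta ++ tau_word w =VA tau_word w ++ sigma_word t.
Proof.
move=> bt; have [u [s [bs ->]]] := Hdelta beta.
by rewrite -!catA; apply: (sigma_conj_eq Hm); rewrite -bs bt.
Qed.

(** Both roots come from the same w, so conjugation by w reduces the relation to (v1) for s and
    t. *)
Lemma hat_rel_delta l r : hat_artin_rel l r -> extend_word delta l =VA extend_word delta r.
Proof.
move=> [b [c [w [s [t [k [nbc [bs [ct [mst [-> ->]]]]]]]]]]].
have nst : s <> t.
  move=> st; apply: nbc; case: b c bs ct => [b Pb] [c Pc] /= bs ct.
  by apply: subset_eq_compat; rewrite bs ct st.
have hb := delta_conj bs; have hc := delta_conj ct.
apply: (pres_eq_cancelr (w := tau_word w)); rewrite !PiRE.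
rewrite (extend_alt_conj k hb hc) (extend_alt_conj k hc hb).
have := @pe_rel _ (va_rel m) (pos_word (alt (inl t) (inl s) k))
  (pos_word (alt (inl s) (inl t) k)) (tau_word w) [::].
rewrite !cats0; apply; left; exists s, t, k.
by split=> //; split=> //; left; rewrite !PiRE.
Qed.

(** Scanning w sigma_s w^{-1} writes the root w(alpha_s) and returns to the identity of W; hence an
    equality of words, not only modulo relations. *)
Lemma scan_extend_delta u : scan [::] (extend_word delta u) = u.
Proof.
elim: u => [|[b e] u IH] //; rewrite extend_word_cons /=.
have [w [s [bs ->]]] := Hdelta b.
have E c : scan [::] ((tau_word w ++ [:: (inl s, c)] ++ inv_word (tau_word w)) ++
    extend_word delta u) = (b, c) :: u.
  rewrite -!catA !scan_cat scan_tau letters_tau /= !scan_inv_tau letters_inv_tau /=.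
  rewrite cats0 (@scan_ext _ [::]) ?IH.
    congr ((_, _) :: _); case: b bs => [b Pb] /= bs.
    by apply: subset_eq_compat.
  by have := coxeq_rev m (rev w); rewrite revK.
case: e; last exact: E.
by rewrite !inv_word_cat inv_wordK -(catA (tau_word w)) E.
Qed.

(** With [p] empty this factors g into its A[hat Gamma] part and its W part; a general [p] is what
    the induction needs. *)
Lemma va_decomposition p g :
  tau_word p ++ g =VA extend_word delta (scan p g) ++ tau_word (p ++ letters g).
Proof.
elim: g p => [|[[s|s] b] g IH] p; first by rewrite !cats0; reflexivity.
- have dp : delta (root_of p s) ++ tau_word p =VA tau_word p ++ sigma_word s.
    exact: delta_conj.
  rewrite [scan _ _]/= extend_word_cons -[letters _]/(letters g) -catA -IH catA.
  rewrite -cat1s catA; case: b => /=; last by rewrite dp; reflexivity.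
  apply: (pres_eq_cancell (w := delta (root_of p s))).
  rewrite !catA pres_eq_invr dp -2!catA /=.
  apply: (pe_free _ (inl s : S + S) false (tau_word p) g).
- rewrite [scan _ _]/= -[letters _]/([:: s] ++ letters g) catA -IH tau_word_cat -catA.
  case: b; last by reflexivity.
  apply: pres_eq_cat; first reflexivity.
  apply: (pres_eq_cancell (w := tau_word [:: s])).
  rewrite [X in _ =VA X]catA -[_ ++ tau_word _]tau_word_cat.
  have -> : tau_word [:: s; s] ++ g =VA g by rewrite tau_sq; reflexivity.
  exact: (pe_free _ (inr s : S + S) false [::] g).
Qed.

Lemma piK_extend_delta u :
  pres_eq (coxeter_rel m) (piK_word (extend_word delta u)) [::].
Proof.
have D b : pres_eq (coxeter_rel m) (piK_word (delta b)) [::].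
  have [w [s [_ ->]]] := Hdelta b.
  by rewrite !piK_word_cat piK_inv pres_eq_invr; reflexivity.
elim: u => [|[b e] u IH]; first exact: pe_refl.
rewrite extend_word_cons piK_word_cat IH cats0 /=; case: e => //.
rewrite piK_inv -[inv_word _]cats0 -(D b) pres_eq_invl; exact: pe_sym (D b).
Qed.

End Delta.
End Scan.

Theorem theorem2p3 (S : countType) (m : S -> S -> option nat)
  (Hm : coxeter_matrix m)
  (delta : roots_of m -> word (S + S))
  (Hdelta : forall beta, is_delta beta (delta beta)) :
  let F := extend_word delta in
  (* well defined homomorphism A[hat Gamma] -> VA[Gamma] *)
  (forall u v, pres_eq (hat_artin_rel (m:=m)) u v -> pres_eq (va_rel m) (F u) (F v)) /\
  (* injective *)
  (forall u v, pres_eq (va_rel m) (F u) (F v) -> pres_eq (hat_artin_rel (m:=m)) u v) /\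
  (* image is exactly KVA[Gamma] = ker pi_K *)
  (forall g : word (S + S),
     pres_eq (coxeter_rel m) (piK_word g) [::] <->
     exists u, pres_eq (va_rel m) (F u) g).
Proof.
move=> F; split; [|split].
- by apply: pres_eq_extend => l r; apply: hat_rel_delta.
- move=> u v /(pres_eq_scan Hm) /(_ [::]).
  by rewrite !(scan_extend_delta Hm Hdelta).
- move=> g; split=> [g1|[u ug]].
    (* For g in the kernel, [letters g] is trivial in W, so the tau factor of the decomposition
       disappears. *)
    exists (scan m [::] g); apply: pe_sym.
    have := va_decomposition Hm Hdelta [::] g => /= dec.
    apply: (pe_trans dec).
    rewrite -[X in pres_eq _ _ X]cats0; apply: pres_eq_cat; first reflexivity.
    exact: (tau_word_proper (letters_coxeq g1)).
  apply: pe_trans (pe_sym (pres_eq_piK ug)) _.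
  exact: piK_extend_delta.
Qed.
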